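(* Let $A$ be a $k$-algebra and let $$[p_1,p_2,p_3]=\big[S_A^{\oplus r_1}\xrightarrow{p_1}M_1,\ S_A^{\oplus r_2}\xrightarrow{p_2}M_2,\ S_A^{\oplus r_1r_2}\xrightarrow{p_3}M_3\big]$$ be an element of $\big(\mathrm{Quot}_{d_1}^{r_1}(\mathbb{A}^n)\times\mathrm{Quot}_{d_2}^{r_2}(\mathbb{A}^n)\times\mathrm{Quot}_{d_3}^{r_1r_2}(\mathbb{A}^n)\big)(A)$, i.e. each $p_i$ is an $S_A$-linear surjection and $M_i$ is locally free of rank $d_i$ over $A$. Let $K_i=\ker p_i$ for $i=1,2$. Then there exists an ideal $I\subseteq A$ such that for every ideal $J\subseteq A$, writing $B=A/J$, the maps $$\psi_1\colon K_1'\otimes S_B^{\oplus r_2}= K_1\otimes S_A^{\oplus r_2}\otimes A/J\to S_B^{\oplus r_1r_2}\to M_3',\qquad \psi_2\colon S_B^{\oplus r_1}\otimes K_2'= S_A^{\oplus r_1}\otimes K_2\otimes A/J\to S_B^{\oplus r_1r_2}\to M_3'$$ are both zero if and only if $I\subseteq J$.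
   Context: Let $k$ be an infinite algebraically closed field, $S=k[x_1,\dots,x_n]$, $\mathbb{A}^n=\operatorname{Spec}S$, and $S_A=S\otimes_kA$ for a $k$-algebra $A$; $n,d_1,d_2,d_3,r_1,r_2\ge1$ are integers. The Quot functor satisfies: $\mathrm{Quot}_d^r(\mathbb{A}^n)(A)$ is the set of $S_A$-linear surjections $S_A^{\oplus r}\twoheadrightarrow M$ with $M$ locally free of rank $d$ as an $A$-module, where surjections with equal kernels are identified. For $B=A/J$, write $p_i'\colon S_B^{\oplus r_i}\twoheadrightarrow M_i'=M_i\otimes_AB$ ($i=1,2$) and $p_3'\colon S_B^{\oplus r_1r_2}\twoheadrightarrow M_3'=M_3\otimes_AB$ for the base changes of $p_1,p_2,p_3$, and $K_i'=\ker p_i'=K_i\otimes_AB$ for $i=1,2$. We identify $S_B^{\oplus r_1}\otimes_{S_B}S_B^{\oplus r_2}=S_B^{\oplus r_1r_2}$, tensor products of modules being over $S_A$ or $S_B$ respectively. The maps $\psi_1,\psi_2$ are the compositions of the maps $K_1'\otimes S_B^{\oplus r_2}\to S_B^{\oplus r_1r_2}$ and $S_B^{\oplus r_1}\otimes K_2'\to S_B^{\oplus r_1r_2}$ induced by the inclusions $K_i'\subseteq S_B^{\oplus r_i}$ with the quotient map $p_3'$. *)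

(* Defs.v *)
From HB Require Import structures.
From mathcomp Require Import all_boot all_order all_algebra.
From mathcomp Require Import boolp.
From mathcomp Require Import mpoly.
From mathcomp Require Import zify.

Set Implicit Arguments.
Unset Strict Implicit.
Unset Printing Implicit Defensive.

Import GRing.Theory.

Local Open Scope ring_scope.
Local Open Scope quotient_scope.

(* The rings are [comPzRingType]s, which may be zero: A / J is zero when
   J = A, and A itself is allowed to be zero.  A k-algebra A is a commutative
   ring with a ring morphism k -> A. *)

(* The R'-module M seen as an R-module through f : R -> R'. *)
Definition restr (R R' : comPzRingType) (f : {rmorphism R -> R'})
  (M : lmodType R') : Type := M.

Section Restriction.
Variables (R R' : comPzRingType) (f : {rmorphism R -> R'}) (M : lmodType R').
Local Notation restr := (restr f M).

HB.instance Definition _ := GRing.Zmodule.copy restr M.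

Definition restr_scale (a : R) (m : restr) : restr := f a *: (m : M).

Fact restr_scaleA a b m : restr_scale a (restr_scale b m) = restr_scale (a * b) m.
Proof. by rewrite /restr_scale rmorphM scalerA. Qed.
Fact restr_scale1 : left_id 1 restr_scale.
Proof. by move=> m; rewrite /restr_scale rmorph1 scale1r. Qed.
Fact restr_scaleDr : right_distributive restr_scale +%R.
Proof. by move=> a m m'; rewrite /restr_scale scalerDr. Qed.
Fact restr_scaleDl m : {morph restr_scale^~ m : a b / a + b}.
Proof. by move=> a b; rewrite /restr_scale rmorphD scalerDl. Qed.

HB.instance Definition _ := GRing.Zmodule_isLmodule.Build R restr
  restr_scaleA restr_scale1 restr_scaleDr restr_scaleDl.

Lemma restrZE a (m : restr) : a *: m = f a *: (m : M) :> M.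
Proof. by []. Qed.

End Restriction.

(* Tensor product of two R-modules: formal finite sums of pairs modulo the
   congruence generated by the bilinearity relations. *)
Section Tensor.
Variables (R : comPzRingType) (M N : lmodType R).

Inductive tensor_eq : seq (M * N) -> seq (M * N) -> Prop :=
| teq_refl s : tensor_eq s s
| teq_sym s t : tensor_eq s t -> tensor_eq t s
| teq_trans s t u : tensor_eq s t -> tensor_eq t u -> tensor_eq s u
| teq_cat s s' t t' :
    tensor_eq s s' -> tensor_eq t t' -> tensor_eq (s ++ t) (s' ++ t')
| teq_catC s t : tensor_eq (s ++ t) (t ++ s)
| teq_Dl m m' n : tensor_eq [:: (m + m', n)] [:: (m, n); (m', n)]
| teq_Dr m n n' : tensor_eq [:: (m, n + n')] [:: (m, n); (m, n')]
| teq_Z a m n : tensor_eq [:: (a *: m, n)] [:: (m, a *: n)]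
| teq_0l n : tensor_eq [:: (0, n)] [::].

Definition tensor_rel : rel (seq (M * N)) := fun s t => `[< tensor_eq s t >].

Fact tensor_rel_equiv : equiv_class_of tensor_rel.
Proof.
split=> [s|s t|t s u].
- exact/asboolP/teq_refl.
- by apply/asboolP/asboolP => /teq_sym.
- by move=> /asboolP h1 /asboolP h2; apply/asboolP/(teq_trans h1 h2).
Qed.
Canonical tensor_rel_equiv_rel := EquivRelPack tensor_rel_equiv.
Canonical tensor_rel_encModRel := defaultEncModRel tensor_rel.

Definition tensor : Type := {eq_quot tensor_rel}.
HB.instance Definition _ := Choice.on tensor.
HB.instance Definition _ : EqQuotient _ tensor_rel tensor := EqQuotient.on tensor.

Definition tclass (s : seq (M * N)) : tensor := \pi_tensor s.

Lemma tclassP s t : reflect (tclass s = tclass t) `[< tensor_eq s t >].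
Proof. exact: (@eqquotP _ _ tensor). Qed.

Lemma tclass_eq s t : tensor_eq s t -> tclass s = tclass t.
Proof. by move=> h; apply/tclassP/asboolP. Qed.

Lemma tclassK x : tclass (repr x) = x.
Proof. exact: reprK. Qed.

Lemma repr_tclass s : tensor_eq (repr (tclass s)) s.
Proof. by apply/asboolP/tclassP; rewrite tclassK. Qed.

Definition tens (m : M) (n : N) : tensor := tclass [:: (m, n)].

Definition tensor_zero : tensor := tclass [::].
Definition tensor_add (x y : tensor) : tensor := tclass (repr x ++ repr y).
Definition tensor_opp (x : tensor) : tensor :=
  tclass [seq (- p.1, p.2) | p <- repr x].
Definition tensor_scale (a : R) (x : tensor) : tensor :=
  tclass [seq (a *: p.1, p.2) | p <- repr x].

Lemma tensor_addE s t : tensor_add (tclass s) (tclass t) = tclass (s ++ t).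
Proof. by apply/tclass_eq/teq_cat; exact: repr_tclass. Qed.

Lemma teq_map (h : M -> M) s t :
    h 0 = 0 -> {morph h : m m' / m + m'} ->
    (forall a m, h (a *: m) = a *: h m) ->
  tensor_eq s t ->
  tensor_eq [seq (h p.1, p.2) | p <- s] [seq (h p.1, p.2) | p <- t].
Proof.
move=> h0 hD hZ; elim=> {s t} /=.
- by move=> s; exact: teq_refl.
- by move=> s t _; exact: teq_sym.
- by move=> s t u _ h1 _ h2; exact: teq_trans h1 h2.
- by move=> s s' t t' _ h1 _ h2; rewrite !map_cat; exact: teq_cat.
- by move=> s t; rewrite !map_cat; exact: teq_catC.
- by move=> m m' n; rewrite hD; exact: teq_Dl.
- by move=> m n n'; exact: teq_Dr.
- by move=> a m n; rewrite hZ; exact: teq_Z.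
- by move=> n; rewrite h0; exact: teq_0l.
Qed.

Lemma tensor_oppE s : tensor_opp (tclass s) = tclass [seq (- p.1, p.2) | p <- s].
Proof.
apply/tclass_eq/teq_map; [exact: oppr0|exact: opprD| |exact: repr_tclass].
by move=> a m; rewrite scalerN.
Qed.

Lemma tensor_scaleE a s :
  tensor_scale a (tclass s) = tclass [seq (a *: p.1, p.2) | p <- s].
Proof.
apply/tclass_eq/teq_map; [exact: scaler0|exact: scalerDr| |exact: repr_tclass].
by move=> b m; rewrite !scalerA mulrC.
Qed.

Fact tensor_addA : associative tensor_add.
Proof.
by move=> x y z; rewrite -[x]tclassK -[y]tclassK -[z]tclassK !tensor_addE catA.
Qed.
Fact tensor_addC : commutative tensor_add.
Proof. by move=> x y; apply/tclass_eq/teq_catC. Qed.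
Fact tensor_add0 : left_id tensor_zero tensor_add.
Proof. by move=> x; rewrite -[x]tclassK tensor_addE. Qed.
Fact tensor_addN : left_inverse tensor_zero tensor_opp tensor_add.
Proof.
move=> x; rewrite -[x]tclassK tensor_oppE tensor_addE; apply: tclass_eq.
elim: (repr x) => [|[m n] s IHs] /=; first exact: teq_refl.
have hmn : tensor_eq [:: (- m, n); (m, n)] [::].
  apply: teq_trans (teq_sym (teq_Dl _ _ _)) _; rewrite addNr; exact: teq_0l.
apply: teq_trans (teq_cat hmn IHs); rewrite -cat1s -[X in tensor_eq _ X]cat1s.
apply: teq_cat; first exact: teq_refl.
rewrite -[X in tensor_eq X _]/(_ ++ ([:: (m, n)] ++ s)) catA.
rewrite -[X in tensor_eq _ X]/([:: (m, n)] ++ (_ ++ s)) catA.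
by apply: teq_cat; [exact: teq_catC|exact: teq_refl].
Qed.

HB.instance Definition _ := GRing.isZmodule.Build tensor
  tensor_addA tensor_addC tensor_add0 tensor_addN.

Lemma tclassD s t : tclass (s ++ t) = tclass s + tclass t.
Proof. by rewrite -tensor_addE. Qed.

Lemma tclass0 : tclass [::] = 0. Proof. by []. Qed.

Lemma tclassE s : tclass s = \sum_(p <- s) tens p.1 p.2.
Proof.
elim: s => [|[m n] s IHs]; first by rewrite big_nil.
by rewrite big_cons -IHs -cat1s tclassD.
Qed.

Fact tensor_scaleA a b x :
  tensor_scale a (tensor_scale b x) = tensor_scale (a * b) x.
Proof.
rewrite -[x]tclassK !tensor_scaleE -map_comp; congr tclass.
by apply: eq_map => -[m n] /=; rewrite scalerA.
Qed.
Fact tensor_scale1 : left_id 1 tensor_scale.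
Proof.
move=> x; rewrite -[x]tclassK tensor_scaleE; congr tclass.
by rewrite -[RHS]map_id; apply: eq_map => -[m n] /=; rewrite scale1r.
Qed.
Fact tensor_scaleDr : right_distributive tensor_scale +%R.
Proof.
move=> a x y; rewrite -[x]tclassK -[y]tclassK -tclassD !tensor_scaleE map_cat.
by rewrite tclassD.
Qed.
Fact tensor_scaleDl x : {morph tensor_scale^~ x : a b / a + b}.
Proof.
move=> a b; rewrite -[x]tclassK !tensor_scaleE !tclassE !big_map /= -big_split /=.
apply: eq_bigr => -[m n] _ /=; rewrite scalerDl.
rewrite -[RHS]tclassD; exact/tclass_eq/teq_Dl.
Qed.

HB.instance Definition _ := GRing.Zmodule_isLmodule.Build R tensor
  tensor_scaleA tensor_scale1 tensor_scaleDr tensor_scaleDl.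

Lemma tensDl m m' n : tens (m + m') n = tens m n + tens m' n.
Proof. by rewrite -[RHS]tclassD; exact/tclass_eq/teq_Dl. Qed.
Lemma tensDr m n n' : tens m (n + n') = tens m n + tens m n'.
Proof. by rewrite -[RHS]tclassD; exact/tclass_eq/teq_Dr. Qed.
Lemma tensZ a m n : tens (a *: m) n = tens m (a *: n).
Proof. exact/tclass_eq/teq_Z. Qed.
Lemma tensZl a m n : tens (a *: m) n = a *: tens m n.
Proof. exact/esym/tensor_scaleE. Qed.
Lemma tensZr a m n : tens m (a *: n) = a *: tens m n.
Proof. by rewrite -tensZ tensZl. Qed.
Lemma tens0l n : tens 0 n = 0.
Proof. exact/tclass_eq/teq_0l. Qed.

Lemma tensorP (x : tensor) : exists s : seq (M * N), x = \sum_(p <- s) tens p.1 p.2.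
Proof. by exists (repr x); rewrite -tclassE tclassK. Qed.

Lemma tensor_ind (P : tensor -> Prop) :
    (forall m n, P (tens m n)) -> (forall x y, P x -> P y -> P (x + y)) ->
  forall x, P x.
Proof.
move=> Pt PD x; have [s ->] := tensorP x.
by elim/big_ind: _ => //; rewrite -(tens0l 0).
Qed.

(* The universal property: [tensor_lift f] is the additive map sending
   [tens m n] to [f m n], provided that f is balanced. *)
Definition balanced (V : zmodType) (f : M -> N -> V) :=
  [/\ forall m m' n, f (m + m') n = f m n + f m' n,
      forall m n n', f m (n + n') = f m n + f m n' &
      forall a m n, f (a *: m) n = f m (a *: n)].

Definition tensor_lift (V : zmodType) (f : M -> N -> V) (x : tensor) : V :=
  \sum_(p <- repr x) f p.1 p.2.

Section Lift.
Variables (V : zmodType) (f : M -> N -> V) (f_bal : balanced f).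

Lemma tensor_lift_class s : tensor_lift f (tclass s) = \sum_(p <- s) f p.1 p.2.
Proof.
have [fDl fDr fZ] := f_bal.
rewrite /tensor_lift; move: (repr _) (repr_tclass s) => t.
elim=> {s t} //.
- by move=> ? ? ? _ -> _ ->.
- by move=> ? ? ? ? _ h1 _ h2; rewrite !big_cat /= h1 h2.
- by move=> ? ?; rewrite !big_cat /= addrC.
- by move=> ? ? ?; rewrite !big_cons !big_nil /= fDl !addr0.
- by move=> ? ? ?; rewrite !big_cons !big_nil /= fDr !addr0.
- by move=> ? ? ?; rewrite !big_cons !big_nil /= fZ.
- move=> n; rewrite big_cons !big_nil /= addr0.
  by apply: (addrI (f 0 n)); rewrite -fDl !addr0.
Qed.

Lemma tensor_lift_tens m n : tensor_lift f (tens m n) = f m n.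
Proof. by rewrite tensor_lift_class big_seq1. Qed.

Lemma tensor_liftD : {morph tensor_lift f : x y / x + y}.
Proof.
move=> x y; rewrite -[x]tclassK -[y]tclassK -tclassD !tensor_lift_class.
by rewrite big_cat.
Qed.

End Lift.

End Tensor.

Definition tensor_map (R : comPzRingType) (M N M' N' : lmodType R)
    (f : M -> M') (g : N -> N') : tensor M N -> tensor M' N' :=
  tensor_lift (fun m n => tens (f m) (g n)).

Lemma tensor_map_tens (R : comPzRingType) (M N M' N' : lmodType R)
    (f : {linear M -> M'}) (g : {linear N -> N'}) m n :
  tensor_map f g (tens m n) = tens (f m) (g n).
Proof.
apply: tensor_lift_tens; split=> [m1 m2 n1|m1 n1 n2|a m1 n1] /=.
- by rewrite linearD tensDl.
- by rewrite linearD tensDr.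
- by rewrite !linearZ tensZ.
Qed.

(* The ring S_A = S (x)_k A, for a k-algebra S. *)
Section Extension.
Variables (k : comNzRingType) (S : comAlgType k).
Variables (A : comPzRingType) (f : {rmorphism k -> A}).

Definition ext : Type := tensor S (restr f A^o).
HB.instance Definition _ := GRing.Zmodule.on ext.

Definition etens (s : S) (a : A) : ext := tens s (a : restr f A^o).

Definition ext_mul (x y : ext) : ext :=
  tensor_lift (fun (s : S) (a : restr f A^o) => tensor_lift
    (fun (s' : S) (a' : restr f A^o) => etens (s * s') ((a : A) * (a' : A))) y) x.

Lemma etensDl s s' a : etens (s + s') a = etens s a + etens s' a.
Proof. exact: tensDl. Qed.
Lemma etensDr s a a' : etens s (a + a') = etens s a + etens s a'.
Proof. exact: tensDr. Qed.
Lemma etensZ c s a : etens (c *: s) a = etens s (f c * a).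
Proof. exact: (@tensZ _ S (restr f A^o)). Qed.

Lemma ext_ind (P : ext -> Prop) :
    (forall s a, P (etens s a)) -> (forall x y, P x -> P y -> P (x + y)) ->
  forall x, P x.
Proof. exact: (@tensor_ind _ S (restr f A^o)). Qed.

Fact ext_mul_inner s a :
  balanced (fun (s' : S) (a' : restr f A^o) => etens (s * s') (a * (a' : A))).
Proof.
split=> [s1 s2 a'|s' a1 a2|c s' a'].
- by rewrite mulrDr etensDl.
- by rewrite -etensDr; congr etens; rewrite mulrDr.
- by rewrite -scalerAr etensZ restrZE mulrCA.
Qed.

Fact ext_mul_outer (y : ext) :
  balanced (fun (s : S) (a : restr f A^o) => tensor_lift
    (fun (s' : S) (a' : restr f A^o) => etens (s * s') ((a : A) * (a' : A))) y).
Proof.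
split=> [s1 s2 a|s a1 a2|c s a]; elim/ext_ind: y => [s' a'|y z IHy IHz].
- by rewrite !(tensor_lift_tens (ext_mul_inner _ _)) mulrDl etensDl.
- rewrite !(tensor_liftD (ext_mul_inner _ _)) IHy IHz; exact: addrACA.
- by rewrite !(tensor_lift_tens (ext_mul_inner _ _)) -etensDr -mulrDl.
- rewrite !(tensor_liftD (ext_mul_inner _ _)) IHy IHz; exact: addrACA.
- rewrite !(tensor_lift_tens (ext_mul_inner _ _)) -scalerAl etensZ restrZE.
  by rewrite mulrA.
- by rewrite !(tensor_liftD (ext_mul_inner _ _)) IHy IHz.
Qed.

Lemma ext_mulE s a s' a' :
  ext_mul (etens s a) (etens s' a') = etens (s * s') (a * a').
Proof.
rewrite /ext_mul (tensor_lift_tens (ext_mul_outer _)).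
exact: (tensor_lift_tens (ext_mul_inner _ _)).
Qed.

Fact ext_mulDl : left_distributive ext_mul +%R.
Proof. by move=> x y z; exact: (tensor_liftD (ext_mul_outer z)). Qed.

Fact ext_mulC : commutative ext_mul.
Proof.
have mulDr z : {morph ext_mul z : x y / x + y}.
  move=> x y; elim/ext_ind: z => [s a|z t IHz IHt].
    rewrite /ext_mul !(tensor_lift_tens (ext_mul_outer _)).
    exact: (tensor_liftD (ext_mul_inner _ _)).
  by rewrite !ext_mulDl IHz IHt; exact: addrACA.
move=> x y; elim/ext_ind: x => [s a|x z IHx IHz]; last first.
  by rewrite ext_mulDl mulDr IHx IHz.
elim/ext_ind: y => [s' a'|x z IHx IHz]; last by rewrite ext_mulDl mulDr IHx IHz.
by rewrite !ext_mulE mulrC [a * _]mulrC.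
Qed.

Fact ext_mulA : associative ext_mul.
Proof.
have mulDr z : {morph ext_mul z : x y / x + y}.
  by move=> x y; rewrite ext_mulC ext_mulDl !(ext_mulC z).
move=> x y z; elim/ext_ind: x => [s a|x x' IHx IHx']; last first.
  by rewrite !ext_mulDl IHx IHx'.
elim/ext_ind: y => [s' a'|y y' IHy IHy']; last first.
  by rewrite ext_mulDl !mulDr ext_mulDl IHy IHy'.
elim/ext_ind: z => [s'' a''|z z' IHz IHz']; last by rewrite !mulDr IHz IHz'.
by rewrite !ext_mulE !mulrA.
Qed.

Fact ext_mul1 : left_id (etens 1 1) ext_mul.
Proof.
move=> x; elim/ext_ind: x => [s a|x y IHx IHy]; first by rewrite ext_mulE !mul1r.
by rewrite ext_mulC ext_mulDl !(ext_mulC _ (etens _ _)) IHx IHy.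
Qed.

HB.instance Definition _ := GRing.Zmodule_isComPzRing.Build ext
  ext_mulA ext_mulC ext_mul1 ext_mulDl.

Lemma etensM s a s' a' : etens s a * etens s' a' = etens (s * s') (a * a').
Proof. exact: ext_mulE. Qed.

Definition ext_in (a : A) : ext := etens 1 a.

Fact ext_in_zmod_morphism : zmod_morphism ext_in.
Proof.
move=> a b; apply: (addIr (ext_in b)).
by rewrite subrK -etensDr subrK.
Qed.
Fact ext_in_monoid_morphism : monoid_morphism ext_in.
Proof. by split=> // a b; rewrite etensM mulr1. Qed.

HB.instance Definition _ :=
  GRing.isZmodMorphism.Build A ext ext_in ext_in_zmod_morphism.
HB.instance Definition _ :=
  GRing.isMonoidMorphism.Build A ext ext_in ext_in_monoid_morphism.

End Extension.

Arguments ext {k} S {A} f.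
Arguments etens {k S A} f s a.
Arguments ext_in {k} S {A} f a.

(* Base change along a k-algebra morphism g : A -> B. *)
Section BaseChange.
Variables (k : comNzRingType) (S : comAlgType k) (A B : comPzRingType).
Variables (f : {rmorphism k -> A}) (g : {rmorphism A -> B}).

Local Notation SA := (ext S f).
Local Notation SB := (ext S (g \o f)).

(* The S_B-module M (x)_A B, on which s (x) b acts by
   m (x) b' |-> (s m) (x) (b b'). *)
Section Module.
Variable M : lmodType SA.

Definition bchange : Type := tensor (restr (ext_in S f) M) (restr g B^o).
HB.instance Definition _ := GRing.Zmodule.on bchange.

Definition btens (m : M) (b : B) : bchange :=
  tens (m : restr (ext_in S f) M) (b : restr g B^o).

Definition bchange_scale (z : SB) (x : bchange) : bchange :=
  tensor_lift (fun (s : S) (b : restr (g \o f) B^o) => tensor_lift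
    (fun (m : restr (ext_in S f) M) (b' : restr g B^o) =>
       btens (etens f s 1 *: (m : M)) ((b : B) * (b' : B))) x) z.

Lemma btensDl m m' b : btens (m + m') b = btens m b + btens m' b.
Proof. exact: tensDl. Qed.
Lemma btensDr m b b' : btens m (b + b') = btens m b + btens m b'.
Proof. exact: tensDr. Qed.
Lemma btensZ a m b : btens (etens f 1 a *: m) b = btens m (g a * b).
Proof. exact: (@tensZ _ (restr (ext_in S f) M) (restr g B^o)). Qed.

Lemma bchange_ind (P : bchange -> Prop) :
    (forall m b, P (btens m b)) -> (forall x y, P x -> P y -> P (x + y)) ->
  forall x, P x.
Proof. exact: (@tensor_ind _ (restr (ext_in S f) M) (restr g B^o)). Qed.

Fact bscale_inner s b : balanced
  (fun (m : restr (ext_in S f) M) (b' : restr g B^o) =>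
     btens (etens f s 1 *: (m : M)) (b * (b' : B))).
Proof.
split=> [m m' b'|m b1 b2|a m b'].
- by rewrite -btensDl -scalerDr.
- by rewrite -btensDr -mulrDr.
- rewrite !restrZE mulrCA -btensZ !scalerA /ext_in mulrC //.
Qed.

Fact bscale_outer (x : bchange) : balanced
  (fun (s : S) (b : restr (g \o f) B^o) => tensor_lift
    (fun (m : restr (ext_in S f) M) (b' : restr g B^o) =>
       btens (etens f s 1 *: (m : M)) ((b : B) * (b' : B))) x).
Proof.
split=> [s1 s2 b|s b1 b2|c s b]; elim/bchange_ind: x => [m b'|x y IHx IHy].
- by rewrite !(tensor_lift_tens (bscale_inner _ _)) -btensDl -scalerDl -etensDl.
- by rewrite !(tensor_liftD (bscale_inner _ _)) IHx IHy addrACA.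
- by rewrite !(tensor_lift_tens (bscale_inner _ _)) -btensDr -mulrDl.
- by rewrite !(tensor_liftD (bscale_inner _ _)) IHx IHy addrACA.
- rewrite !(tensor_lift_tens (bscale_inner _ _)) restrZE -mulrA -btensZ scalerA.
  by rewrite etensM mul1r mulr1 etensZ mulr1.
- by rewrite !(tensor_liftD (bscale_inner _ _)) IHx IHy.
Qed.

Lemma bchange_scaleE s b m b' :
  bchange_scale (etens (g \o f) s b) (btens m b') =
  btens (etens f s 1 *: m) (b * b').
Proof.
rewrite /bchange_scale (tensor_lift_tens (bscale_outer _)).
exact: (tensor_lift_tens (bscale_inner _ _)).
Qed.

Fact bchange_scaleDl x : {morph bchange_scale^~ x : z t / z + t}.
Proof. by move=> z t; exact: (tensor_liftD (bscale_outer x)). Qed.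

Fact bchange_scaleDr : right_distributive bchange_scale +%R.
Proof.
move=> z x y; elim/ext_ind: z => [s b|z t IHz IHt].
  rewrite /bchange_scale !(tensor_lift_tens (bscale_outer _)).
  exact: (tensor_liftD (bscale_inner _ _)).
by rewrite !bchange_scaleDl IHz IHt addrACA.
Qed.

Fact bchange_scale1 : left_id 1 bchange_scale.
Proof.
move=> x; elim/bchange_ind: x => [m b|x y IHx IHy]; last first.
  by rewrite bchange_scaleDr IHx IHy.
by rewrite bchange_scaleE scale1r mul1r.
Qed.

Fact bchange_scaleA z t x :
  bchange_scale z (bchange_scale t x) = bchange_scale (z * t) x.
Proof.
elim/ext_ind: z => [s b|z z' IHz IHz']; last first.
  by rewrite mulrDl !bchange_scaleDl IHz IHz'.
elim/ext_ind: t => [s' b'|t t' IHt IHt']; last first.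
  by rewrite mulrDr !bchange_scaleDl bchange_scaleDr IHt IHt'.
elim/bchange_ind: x => [m b''|x y IHx IHy]; last first.
  by rewrite !bchange_scaleDr IHx IHy.
by rewrite etensM !bchange_scaleE scalerA etensM mulr1 mulrA.
Qed.

HB.instance Definition _ := GRing.Zmodule_isLmodule.Build SB bchange
  bchange_scaleA bchange_scale1 bchange_scaleDr bchange_scaleDl.

Lemma btensE s b m b' :
  etens (g \o f) s b *: btens m b' = btens (etens f s 1 *: m) (b * b').
Proof. exact: bchange_scaleE. Qed.

End Module.

Definition ext_map : SA -> SB :=
  tensor_lift (fun (s : S) (a : restr f A^o) => etens (g \o f) s (g a)).

Lemma ext_map_bal :
  balanced (fun (s : S) (a : restr f A^o) => etens (g \o f) s (g a)).
Proof.
split=> [s s' a|s a a'|c s a].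
- by rewrite etensDl.
- by rewrite -etensDr -rmorphD.
- by rewrite etensZ restrZE rmorphM.
Qed.

Lemma ext_mapE s a : ext_map (etens f s a) = etens (g \o f) s (g a).
Proof. exact: (tensor_lift_tens ext_map_bal). Qed.

Lemma ext_mapD : {morph ext_map : x y / x + y}.
Proof. exact: (tensor_liftD ext_map_bal). Qed.

Lemma btens_ext_map (M : lmodType SA) x (m : M) b :
  ext_map x *: btens m b = btens (x *: m) b.
Proof.
elim/ext_ind: x => [s a|x y IHx IHy]; last first.
  by rewrite ext_mapD !scalerDl IHx IHy btensDl.
rewrite ext_mapE btensE -btensZ scalerA etensM mul1r mulr1 //.
Qed.

(* The base change p' : S_B^r -> M (x)_A B of an S_A-linear map p : S_A^r -> M,
   i.e. p (x)_A B under S_A^r (x)_A B = S_B^r; see [bchange_mapE]. *)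
Section Map.
Variables (r : nat) (M : lmodType SA) (p : {linear 'rV[SA]_r -> M}).

Definition bchange_map (v : 'rV[SB]_r) : bchange M :=
  \sum_(j < r) v 0 j *: btens (p (delta_mx 0 j)) 1.

Fact bchange_map_linear : linear bchange_map.
Proof.
move=> a u v; rewrite /bchange_map scaler_sumr -big_split /=.
by apply: eq_bigr => j _; rewrite !mxE scalerDl scalerA.
Qed.
HB.instance Definition _ :=
  GRing.isLinear.Build SB 'rV[SB]_r (bchange M) *:%R bchange_map
    bchange_map_linear.

Lemma bchange_mapE (v : 'rV[SA]_r) b :
  bchange_map (\row_j (ext_map (v 0 j) * etens (g \o f) 1 b)) = btens (p v) b.
Proof.
rewrite {2}[v]row_sum_delta linear_sum /bchange_map.
rewrite (big_morph (fun m => btens m b) (fun m m' => btensDl m m' b) (id1 := 0)).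
  apply: eq_bigr => j _; rewrite mxE -scalerA btensE linearZ /= -btens_ext_map.
  by rewrite mulr1 !btens_ext_map -[etens f 1 1]/(1 : SA) scale1r.
exact: (@tens0l _ (restr (ext_in S f) M) (restr g B^o)).
Qed.

End Map.

End BaseChange.

Arguments bchange {k S A B f} g M.
Arguments bchange_map {k S A B f} g {r M} p v.
Arguments ext_map {k} S {A B} f g x.

(* Ideals, the whole ring included: unlike [idealr] of ring_quotient, which is
   restricted to proper ideals of nonzero rings. *)
Record ideal (A : comPzRingType) := Ideal {
  ideal_pred :> {pred A};
  ideal0 : 0 \in ideal_pred;
  idealD : {in ideal_pred &, forall x y, x + y \in ideal_pred};
  idealM : forall a, {in ideal_pred, forall x, a * x \in ideal_pred}
}.

Section QuotientRing.
Variables (A : comPzRingType) (J : ideal A).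

Fact ideal_zmod_closed : zmod_closed (ideal_pred J).
Proof.
split=> [|x y Jx Jy]; first exact: ideal0.
by rewrite -[- y]mulN1r; apply: idealD => //; exact: idealM.
Qed.
HB.instance Definition _ :=
  GRing.isZmodClosed.Build A (ideal_pred J) ideal_zmod_closed.

Definition quotring : Type := Quotient.quot (ideal_pred J).
HB.instance Definition _ := GRing.Zmodule.on quotring.

Definition quotpi (a : A) : quotring := \pi_(Quotient.quot (ideal_pred J)) a.

Lemma quotpiP a b : reflect (quotpi a = quotpi b) (a - b \in J).
Proof.
have -> : (a - b \in J) = (a == b %[mod Quotient.quot (ideal_pred J)]).
  exact: Quotient.idealrBE.
exact: eqP.
Qed.

Lemma quotpi_surj (x : quotring) : exists a, quotpi a = x.
Proof. by exists (repr (x : Quotient.quot (ideal_pred J))); exact: reprK. Qed.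

Definition quot_mul (x y : quotring) : quotring :=
  quotpi (repr (x : Quotient.quot (ideal_pred J)) *
          repr (y : Quotient.quot (ideal_pred J))).

Fact quotpiD : {morph quotpi : a b / a + b}.
Proof. by move=> a b; rewrite /quotpi !piE. Qed.

Fact quotpi_mul a b : quot_mul (quotpi a) (quotpi b) = quotpi (a * b).
Proof.
apply/quotpiP; set a' := repr _; set b' := repr _.
have Ja : a' - a \in J by apply/quotpiP; exact: reprK.
have Jb : b' - b \in J by apply/quotpiP; exact: reprK.
have -> : a' * b' - a * b = b' * (a' - a) + a * (b' - b).
  by rewrite !mulrBr ![b' * _]mulrC addrA subrK.
by apply: idealD; exact: idealM.
Qed.

Fact quot_mulA : associative quot_mul.
Proof.
move=> x y z; have [a <-] := quotpi_surj x; have [b <-] := quotpi_surj y.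
by have [c <-] := quotpi_surj z; rewrite !quotpi_mul mulrA.
Qed.
Fact quot_mulC : commutative quot_mul.
Proof. by move=> x y; rewrite /quot_mul mulrC. Qed.
Fact quot_mul1 : left_id (quotpi 1) quot_mul.
Proof. by move=> x; have [a <-] := quotpi_surj x; rewrite quotpi_mul mul1r. Qed.
Fact quot_mulDl : left_distributive quot_mul +%R.
Proof.
move=> x y z; have [a <-] := quotpi_surj x; have [b <-] := quotpi_surj y.
by have [c <-] := quotpi_surj z; rewrite -quotpiD !quotpi_mul -quotpiD mulrDl.
Qed.

HB.instance Definition _ := GRing.Zmodule_isComPzRing.Build quotring
  quot_mulA quot_mulC quot_mul1 quot_mulDl.

Fact quotpi_zmod_morphism : zmod_morphism quotpi.
Proof. by move=> a b; apply: (addIr (quotpi b)); rewrite subrK -quotpiD subrK. Qed.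
Fact quotpi_monoid_morphism : monoid_morphism quotpi.
Proof. by split=> // a b; rewrite -quotpi_mul. Qed.
HB.instance Definition _ :=
  GRing.isZmodMorphism.Build A quotring quotpi quotpi_zmod_morphism.
HB.instance Definition _ :=
  GRing.isMonoidMorphism.Build A quotring quotpi quotpi_monoid_morphism.

End QuotientRing.

(* Localization at the powers of f: the pair (m, i) stands for m / f ^ i. *)
Section Localization.
Variables (R : comPzRingType) (f : R).

Section Module.
Variable M : lmodType R.

Definition loc_rel : rel (M * nat) := fun x y =>
  `[< exists N, f ^+ (N + y.2) *: x.1 = f ^+ (N + x.2) *: y.1 >].

Fact loc_rel_equiv : equiv_class_of loc_rel.
Proof.
have sym x y : loc_rel x y -> loc_rel y x.
  by move=> /asboolP [N e]; apply/asboolP; exists N.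
split=> [x|x y|y x z]; first by apply/asboolP; exists 0%N.
  by apply/idP/idP; exact: sym.
move=> /asboolP [N1 e1] /asboolP [N2 e2]; apply/asboolP.
exists (N1 + N2 + y.2)%N.
have -> : (N1 + N2 + y.2 + z.2 = (N2 + z.2) + (N1 + y.2))%N by lia.
have -> : (N1 + N2 + y.2 + x.2 = (N1 + x.2) + (N2 + y.2))%N by lia.
rewrite [in LHS]exprD -scalerA e1 scalerA -exprD addnC exprD -scalerA e2.
by rewrite scalerA -exprD.
Qed.
Canonical loc_rel_equiv_rel := EquivRelPack loc_rel_equiv.
Canonical loc_rel_encModRel := defaultEncModRel loc_rel.

Definition loc : Type := {eq_quot loc_rel}.
HB.instance Definition _ := Choice.on loc.
HB.instance Definition _ : EqQuotient _ loc_rel loc := EqQuotient.on loc.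

Definition frac (m : M) (i : nat) : loc := \pi_loc (m, i).

Lemma fracP m i m' j :
  frac m i = frac m' j <-> exists N, f ^+ (N + j) *: m = f ^+ (N + i) *: m'.
Proof.
by split=> [/(@eqquotP _ _ loc)/asboolP //|h]; apply/(@eqquotP _ _ loc)/asboolP.
Qed.

Lemma loc_ind (P : loc -> Prop) : (forall m i, P (frac m i)) -> forall x, P x.
Proof. by move=> h x; rewrite -[x]reprK; case: (repr x). Qed.

Lemma fracX m i n : frac (f ^+ n *: m) (i + n) = frac m i.
Proof. by apply/fracP; exists 0%N; rewrite !add0n scalerA -exprD. Qed.

Definition loc_zero : loc := frac 0 0.
Definition loc_opp (x : loc) : loc := let: (m, i) := repr x in frac (- m) i.
Definition loc_add (x y : loc) : loc :=
  let: (m, i) := repr x in let: (m', j) := repr y in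
  frac (f ^+ j *: m + f ^+ i *: m') (i + j).

Lemma repr_frac m i : exists N,
  f ^+ (N + i) *: (repr (frac m i)).1 = f ^+ (N + (repr (frac m i)).2) *: m.
Proof. by apply/fracP; rewrite -[RHS]reprK; case: (repr (frac m i)). Qed.

Lemma loc_oppE m i : loc_opp (frac m i) = frac (- m) i.
Proof.
rewrite /loc_opp; have := repr_frac m i; case: (repr _) => m' i' /= [N e].
by apply/fracP; exists N; rewrite !scalerN e.
Qed.

Lemma loc_addE m i m' j :
  loc_add (frac m i) (frac m' j) = frac (f ^+ j *: m + f ^+ i *: m') (i + j).
Proof.
rewrite /loc_add; have := repr_frac m i; case: (repr _) => n i' /= [N e].
have := repr_frac m' j; case: (repr _) => n' j' /= [N' e'].
apply/fracP; exists (N + N')%N; rewrite !scalerDr !scalerA -!exprD.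
congr (_ + _).
  have -> : (N + N' + (i + j) + j' = (N' + j + j') + (N + i))%N by lia.
  rewrite exprD -scalerA e scalerA -exprD; congr (_ ^+ _ *: _).
  lia.
have -> : (N + N' + (i + j) + i' = (N + i + i') + (N' + j))%N by lia.
rewrite exprD -scalerA e' scalerA -exprD; congr (_ ^+ _ *: _).
lia.
Qed.

Fact loc_addA : associative loc_add.
Proof.
move=> x y z; elim/loc_ind: x => m i; elim/loc_ind: y => m' j.
elim/loc_ind: z => m'' l; rewrite !loc_addE addnA; congr frac.
by rewrite !scalerDr !scalerA -!exprD addrA ![(l + _)%N]addnC.
Qed.
Fact loc_addC : commutative loc_add.
Proof.
move=> x y; elim/loc_ind: x => m i; elim/loc_ind: y => m' j.
by rewrite !loc_addE addrC addnC.
Qed.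
Fact loc_add0 : left_id loc_zero loc_add.
Proof.
move=> x; elim/loc_ind: x => m i.
by rewrite loc_addE scaler0 !add0r expr0 scale1r.
Qed.
Fact loc_addN : left_inverse loc_zero loc_opp loc_add.
Proof.
move=> x; elim/loc_ind: x => m i; rewrite loc_oppE loc_addE scalerN addNr.
by apply/fracP; exists 0%N; rewrite !scaler0.
Qed.

HB.instance Definition _ := GRing.isZmodule.Build loc
  loc_addA loc_addC loc_add0 loc_addN.

Lemma fracD m i m' j :
  frac m i + frac m' j = frac (f ^+ j *: m + f ^+ i *: m') (i + j).
Proof. exact: loc_addE. Qed.

Lemma fracDl m m' i : frac (m + m') i = frac m i + frac m' i.
Proof. by rewrite fracD -scalerDr fracX. Qed.

End Module.

Definition loc_scale (M : lmodType R) (x : loc R^o) (y : loc M) : loc M :=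
  let: (a, i) := repr x in let: (m, j) := repr y in
  frac ((a : R) *: m) (i + j).

Lemma loc_scaleE (M : lmodType R) a i (m : M) j :
  loc_scale (frac (a : R^o) i) (frac m j) = frac (a *: m) (i + j).
Proof.
rewrite /loc_scale; have := repr_frac (a : R^o) i; case: (repr _) => b i' /= [N e].
have := repr_frac m j; case: (repr _) => n j' /= [N' e'].
apply/fracP; exists (N + N')%N; rewrite !scalerA.
have -> : (N + N' + (i + j) = (N + i) + (N' + j))%N by lia.
have -> : (N + N' + (i' + j') = (N + i') + (N' + j'))%N by lia.
have {}e : f ^+ (N + i) * (b : R) = f ^+ (N + i') * a by exact: e.
rewrite !(exprD _ (N + _)) [in LHS]mulrAC [in RHS]mulrAC e.
by rewrite -[in LHS]scalerA -[in RHS]scalerA e'.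
Qed.

Fact loc_scaleDr (M : lmodType R) x : {morph loc_scale (M := M) x : y z / y + z}.
Proof.
move=> y z; elim/loc_ind: x => a i; elim/loc_ind: y => m j.
elim/loc_ind: z => m' l; rewrite fracD !loc_scaleE fracD.
rewrite -(fracX _ (i + (j + l)) i); congr frac; last by lia.
rewrite !scalerDr !scalerA !exprD.
by congr (_ *: _ + _ *: _); exact: mulrAC.
Qed.

Fact loc_scaleDl (M : lmodType R) (y : loc M) :
  {morph (@loc_scale M)^~ y : x z / x + z}.
Proof.
move=> x z; elim/loc_ind: x => a i; elim/loc_ind: z => b l.
elim/loc_ind: y => m j; rewrite fracD !loc_scaleE fracD.
rewrite -(fracX _ (i + l + j) j); congr frac; last by lia.
rewrite scalerDl scalerDr !scalerA !exprD.
by rewrite ![f ^+ _ * f ^+ j]mulrC; congr (_ *: _ + _ *: _); exact: mulrA.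
Qed.

Fact loc_scale_comp (M : lmodType R) x y (z : loc M) :
  loc_scale x (loc_scale y z) = loc_scale (loc_scale x y) z.
Proof.
elim/loc_ind: x => a i; elim/loc_ind: y => b j; elim/loc_ind: z => m l.
by rewrite !loc_scaleE scalerA addnA.
Qed.

Fact loc_scale_id (M : lmodType R) : left_id (frac (1 : R^o) 0) (@loc_scale M).
Proof. by move=> y; elim/loc_ind: y => m j; rewrite loc_scaleE scale1r. Qed.

Fact loc_scaleC (x y : loc R^o) : loc_scale x y = loc_scale y x.
Proof.
elim/loc_ind: x => a i; elim/loc_ind: y => b j.
by rewrite !loc_scaleE addnC; congr frac; exact: mulrC.
Qed.

Definition locring : Type := loc R^o.
HB.instance Definition _ := GRing.Zmodule.on locring.
HB.instance Definition _ := GRing.Zmodule_isComPzRing.Build locring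
  (@loc_scale_comp R^o) loc_scaleC (@loc_scale_id R^o)
  (fun x y z : locring => loc_scaleDl z x y).

HB.instance Definition _ (M : lmodType R) :=
  GRing.Zmodule_isLmodule.Build locring (loc M)
    (@loc_scale_comp M) (@loc_scale_id M) (@loc_scaleDr M) (@loc_scaleDl M).

End Localization.

(* Spec R is covered by the open sets D(f_i) -- i.e. the f_i generate the unit
   ideal -- such that each M_{f_i} is a free R_{f_i}-module of rank d. *)
Definition locally_free (R : comPzRingType) (M : lmodType R) (d : nat) : Prop :=
  exists (m : nat) (f : 'I_m -> R),
    (exists c : 'I_m -> R, \sum_(i < m) c i * f i = 1) /\
    forall i, exists phi : {linear 'rV[locring (f i)]_d -> loc (f i) M},
      bijective phi.

Section Kernel.
Variables (R : comPzRingType) (U V : lmodType R) (p : {linear U -> V}).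

Definition in_ker : {pred U} := fun u => p u == 0.

Fact in_ker_submod_closed : submod_closed in_ker.
Proof.
split=> [|a u v]; rewrite !unfold_in ?linear0 // linearP.
by move=> /eqP -> /eqP ->; rewrite scaler0 addr0.
Qed.
HB.instance Definition _ :=
  GRing.isSubmodClosed.Build R U in_ker in_ker_submod_closed.

Record ker : Type := Ker { ker_val : U; _ : ker_val \in in_ker }.
HB.instance Definition _ := [isSub for ker_val].
HB.instance Definition _ := [Choice of ker by <:].
HB.instance Definition _ := [SubChoice_isSubLmodule of ker by <:].

End Kernel.

(* The identification R^r1 (x) R^r2 = R^(r1 * r2): e_i (x) e_j is the basis
   vector of index [mxvec_index i j]. *)
Definition free_tensor (R : comPzRingType) (r1 r2 : nat) :
    tensor 'rV[R]_r1 'rV[R]_r2 -> 'rV[R]_(r1 * r2) :=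
  tensor_lift (fun u v => mxvec (u^T *m v)).

Lemma free_tensor_tens (R : comPzRingType) (r1 r2 : nat)
    (u : 'rV[R]_r1) (v : 'rV[R]_r2) :
  free_tensor (tens u v) = mxvec (u^T *m v).
Proof.
apply: tensor_lift_tens; split=> [u1 u2 v1|u1 v1 v2|a u1 v1].
- by rewrite linearD mulmxDl linearD.
- by rewrite mulmxDr linearD.
- by rewrite linearZ /= -scalemxAl -scalemxAr.
Qed.

(* The maps K_1 (x) R^r2 -> R^(r1 r2) -> M and R^r1 (x) K_2 -> R^(r1 r2) -> M,
   with K_i the kernel of p_i. *)
Section Psi.
Variables (R : comPzRingType) (r1 r2 : nat) (M1 M2 M3 : lmodType R).
Variables (p1 : {linear 'rV[R]_r1 -> M1}) (p2 : {linear 'rV[R]_r2 -> M2}).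
Variable p3 : {linear 'rV[R]_(r1 * r2) -> M3}.

Definition psi1 (z : tensor (ker p1) 'rV[R]_r2) : M3 :=
  p3 (free_tensor (tensor_map (ker_val (p := p1)) idfun z)).

Definition psi2 (z : tensor 'rV[R]_r1 (ker p2)) : M3 :=
  p3 (free_tensor (tensor_map idfun (ker_val (p := p2)) z)).

Lemma psi1_tens (u : ker p1) (v : 'rV[R]_r2) :
  psi1 (tens u v) = p3 (mxvec ((ker_val u)^T *m v)).
Proof.
rewrite /psi1 (tensor_map_tens (val : {linear ker p1 -> 'rV_r1}) idfun).
by rewrite free_tensor_tens.
Qed.

Lemma psi2_tens (u : 'rV[R]_r1) (v : ker p2) :
  psi2 (tens u v) = p3 (mxvec (u^T *m ker_val v)).
Proof.
rewrite /psi2 (tensor_map_tens idfun (val : {linear ker p2 -> 'rV_r2})).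
by rewrite free_tensor_tens.
Qed.

End Psi.

Arguments psi1 {R r1 r2 M1 M3} p1 p3 z.
Arguments psi2 {R r1 r2 M2 M3} p2 p3 z.

(* p represents an A-point of Quot^r_d(A^n). *)
Definition is_quot_point (k : comNzRingType) (n d r : nat) (A : comPzRingType)
    (iota : {rmorphism k -> A}) (M : lmodType (ext {mpoly k[n]} iota))
    (p : {linear 'rV[ext {mpoly k[n]} iota]_r -> M}) : Prop :=
  (forall x : M, exists v, p v = x) /\
  locally_free (restr (ext_in {mpoly k[n]} iota) M) d.

(* Main.v *)
From HB Require Import structures.
Require Import Defs.
From mathcomp Require Import all_boot all_order all_algebra.
From mathcomp Require Import mpoly.
From mathcomp Require Import boolp.

Set Implicit Arguments.
Unset Strict Implicit.
Unset Printing Implicit Defensive.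

Import GRing.Theory.

Local Open Scope ring_scope.

(** An A-module M that is locally free of finite rank has a finite dual basis:
    elements e_t and A-linear coordinates eps_t with x = sum_t eps_t(x) e_t for all x (this says
    that M is finitely generated projective).  With such coordinates, the image
    of x in M (x) A/J vanishes if and only if all eps_t(x) lie in J.  Hence the
    vanishing modulo J of any family of elements of M3 is the condition that J
    contains the ideal generated by their coordinates.

    Both psi1 and psi2 vanish exactly when p3' kills the products u' (x) v' with
    u' in K1' or v' in K2'.  By [ker_lift], every element of K_i' lifts to
    K_i: reduction modulo J is surjective, and if p_i(v) lies in J M_i, then v
    can be corrected by a J-combination of vectors so as to lie in K_i.
    So psi1 = psi2 = 0 over A/J means that the images of p3(u (x) v), for u in
    K1 or v in K2, vanish in M3 (x) A/J, and I is the ideal generated by the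
    coordinates of these elements of M3.

    The dual basis is glued from bases (b_il)_l of the localizations M_{f_i},
    where the f_i generate the unit ideal.  The b_il together generate M.
    Multiplying by a power of f_i turns the coordinates with respect to
    (b_il)_l into maps on the free module on these generators; for them to
    descend to M, one more power of f_i has to kill their values on all
    relations at once.  Such a power exists because the relations are locally
    generated by finitely many explicit ones ([relation_coordinates]).  A
    partition of unity then adds up the local coordinates. *)

Local Notation frac := Defs.frac.

(** * Local-to-global arguments *)

Lemma exists_uniform_bound (T : finType) (Q : T -> nat -> Prop) :
    (forall t N N', (N <= N')%N -> Q t N -> Q t N') ->
  (forall t, exists N, Q t N) -> exists N, forall t, Q t N.
Proof.
move=> Qmono /choice[N QN]; exists (\max_t N t)%N => t.
by apply: Qmono (QN t); exact: leq_bigmax.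
Qed.

Section LocalToGlobal.
Variables (A : comPzRingType) (V : lmodType A) (W : V -> Prop).
Hypothesis W0 : W 0.
Hypothesis WD : forall x y, W x -> W y -> W (x + y).
Hypothesis WZ : forall a x, W x -> W (a *: x).

Lemma sum_mem (I : Type) (s : seq I) (F : I -> V) :
  (forall i, W (F i)) -> W (\sum_(i <- s) F i).
Proof. by move=> WF; elim/big_ind: _. Qed.

(** With [local_mem]: the u with a power carrying x into W form an ideal, the
    radical of (W : x); it is the unit ideal if it contains the f_i. *)
Lemma power_colonD (x : V) (u v : A) a b :
  W (u ^+ a *: x) -> W (v ^+ b *: x) -> W ((u + v) ^+ (a + b) *: x).
Proof.
move=> Wu Wv; rewrite exprDn scaler_suml; apply: sum_mem => i.
rewrite -scalerMnl -scaler_nat; apply: WZ.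
case: (leqP b i) => [le_bi|lt_ib].
  by rewrite -(subnK le_bi) exprD mulrA -scalerA; exact: WZ.
have le_a : (a <= a + b - i)%N by rewrite -addnBA ?leq_addr // ltnW.
by rewrite -(subnK le_a) exprD mulrC mulrA -scalerA; exact: WZ.
Qed.

Lemma local_mem (m : nat) (f c : 'I_m -> A) (x : V) :
    \sum_(i < m) c i * f i = 1 ->
  (forall i, exists N, W (f i ^+ N *: x)) -> W x.
Proof.
move=> cf1 Wf.
suff [N] : exists N, W (1 ^+ N *: x) by rewrite expr1n scale1r.
rewrite -cf1; elim/big_ind: _ => [|u v [a Wu] [b Wv]|i _].
- by exists 1%N; rewrite expr1 scale0r.
- by exists (a + b)%N; exact: power_colonD.
- by have [N WN] := Wf i; exists N; rewrite exprMn -scalerA; exact: WZ.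
Qed.

End LocalToGlobal.

(** * Dual bases of locally free modules *)

Section DualBasis.
Variables (A : comPzRingType) (V : lmodType A).

Definition dual_basis (T : finType) (e : T -> V) (eps : T -> V -> A) : Prop :=
  [/\ forall t x y, eps t (x + y) = eps t x + eps t y,
      forall t a x, eps t (a *: x) = a * eps t x &
      forall x, x = \sum_t eps t x *: e t].

(** The images of the b_l form a basis of the localization of V at f, with
    denominators cleared. *)
Definition basis_away (f : A) (d : nat) (b : 'I_d -> V) : Prop :=
  (forall x, exists N c, f ^+ N *: x = \sum_l c l *: b l) /\
  (forall c, \sum_l c l *: b l = 0 -> forall l, exists N, f ^+ N * c l = 0).

(** Powers of f are units in the localization, so the numerators of the images
    of the standard basis vectors still form a basis. *)
Lemma loc_free_basis (f : A) d (phi : {linear 'rV[locring f]_d -> loc f V}) :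
  bijective phi -> exists b : 'I_d -> V, basis_away f b.
Proof.
case=> psi phiK psiK.
have /choice[b] : forall l, exists n, exists e, phi (delta_mx 0 l) = frac f n e.
  by move=> l; elim/loc_ind: (phi _) => n e; exists n, e.
move=> /choice[e phiE].
have phi_sum v : phi v = \sum_l v 0 l *: frac f (b l) (e l).
  rewrite {1}[v]row_sum_delta linear_sum.
  by apply: eq_bigr => l _; rewrite linearZ /= phiE.
exists b; split=> [x|c cb0 l].
- have : exists c K, phi (psi (frac f x 0)) = frac f (\sum_l c l *: b l) K.
    rewrite phi_sum; elim/big_ind: _ => [|y z [c [K ->]] [c' [K' ->]]|l _].
    + by exists (fun=> 0), 0%N; rewrite big1 // => l _; rewrite scale0r.
    + exists (fun l => f ^+ K' * c l + f ^+ K * c' l), (K + K')%N.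
      rewrite fracD; congr frac; rewrite !scaler_sumr -big_split /=.
      by apply: eq_bigr => l _; rewrite scalerDl !scalerA.
    + elim/(@loc_ind _ f): (psi _ 0 l) => a i.
      exists (fun l' => if l' == l then a else 0), (i + e l)%N.
      rewrite (bigD1 l) //= eqxx big1 ?addr0 => [|l' /negPf->].
        exact: loc_scaleE.
      by rewrite scale0r.
  case=> c [K]; rewrite psiK => /fracP[N /= eN].
  exists (N + K)%N, (fun l => f ^+ (N + 0) * c l).
  by rewrite eN scaler_sumr; apply: eq_bigr => j _; rewrite scalerA.
- (* The factor f ^ e_l cancels the denominator of phi(delta_l), so that phi v
     is the image of sum_l c_l b_l. *)
  pose v : 'rV[locring f]_d := \row_l (frac f ((c l * f ^+ e l) : A^o) 0 : locring f).
  have v0 : v = 0.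
    apply: (can_inj phiK); rewrite linear0 phi_sum.
    transitivity (frac f (\sum_l c l *: b l) 0); last by rewrite cb0.
    rewrite (big_morph (fun x => frac f x 0) (fun x y => fracDl f x y 0) (id1 := 0)) //.
    apply: eq_bigr => j _; rewrite mxE.
    transitivity (frac f ((c j * f ^+ e j) *: b j) (0 + e j)); first exact: loc_scaleE.
    by rewrite mulrC -scalerA fracX.
  have : frac f ((c l * f ^+ e l) : A^o) 0 = frac f (0 : A^o) 0.
    by move/rowP/(_ l): v0; rewrite !mxE.
  move=> /fracP[N]; rewrite scaler0 => eN.
  exists (N + 0 + e l)%N; rewrite exprD mulrAC -mulrA; exact: eN.
Qed.

Section Gluing.
Variables (m d : nat) (f c : 'I_m -> A) (b : 'I_m -> 'I_d -> V).
Hypothesis cf1 : \sum_(i < m) c i * f i = 1.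
Hypothesis b_basis : forall i, basis_away (f i) (b i).

Local Notation T := ('I_m * 'I_d)%type.
Let g (t : T) := b t.1 t.2.

Lemma glued_generators x : exists v : T -> A, x = \sum_t v t *: g t.
Proof.
pose W x := exists v : T -> A, x = \sum_t v t *: g t.
have W0 : W 0 by exists (fun=> 0); rewrite big1 // => t _; rewrite scale0r.
have WD y z : W y -> W z -> W (y + z).
  move=> [v ->] [w ->]; exists (fun t => v t + w t); rewrite -big_split /=.
  by apply: eq_bigr => t _; rewrite scalerDl.
have WZ a y : W y -> W (a *: y).
  move=> [v ->]; exists (fun t => a * v t); rewrite scaler_sumr.
  by apply: eq_bigr => t _; rewrite scalerA.
apply: (local_mem W0 WD WZ cf1) => i.
have [N [a xE]] := (b_basis i).1 x; exists N; rewrite xE.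
apply: sum_mem => // l; apply: WZ; exists (fun t => (t == (i, l))%:R).
rewrite (bigD1 (i, l)) //= eqxx scale1r big1 ?addr0 // => t /negPf->.
exact: scale0r.
Qed.

(** A single exponent N does because there are finitely many pairs (i, t). *)
Lemma uniform_coordinates : exists N (P : 'I_m -> T -> 'I_d -> A),
  forall i t, f i ^+ N *: g t = \sum_l P i t l *: b i l.
Proof.
pose Q (it : 'I_m * T) N :=
  exists a, f it.1 ^+ N *: g it.2 = \sum_l a l *: b it.1 l.
have [[i t] N N' le_N [a aE]|[i t]|N QN] := @exists_uniform_bound _ Q.
- exists (fun l => f i ^+ (N' - N) * a l) => /=.
  rewrite -{1}(subnK le_N) exprD -scalerA aE scaler_sumr.
  by apply: eq_bigr => l _; rewrite scalerA.
- exact: (b_basis i).1.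
have [P PE] := choice QN.
by exists N, (fun i t => P (i, t)) => i t; exact: (PE (i, t)).
Qed.

Lemma torsion_uniform (T' : finType) i (y : T' -> A) :
    (forall t, exists N, f i ^+ N * y t = 0) ->
  exists N, forall t, f i ^+ N * y t = 0.
Proof.
apply: exists_uniform_bound => t N N' le_N yN.
by rewrite -(subnK le_N) exprD -mulrA yN mulr0.
Qed.

(** The exponent E depends neither on the relation v nor on i, which is what
    makes v |-> f_i^E sum_t v_t P_itl descend to V.  Over the localization at
    f_k every relation is a combination of those which express f_k^N g_t in
    the basis (b_kl)_l, so it suffices that f_i^E kills the coordinates of
    these finitely many relations; [local_mem] removes the powers of f_k, whose
    exponents do depend on v. *)
Lemma relation_coordinates : exists N E (P : 'I_m -> T -> 'I_d -> A),
  (forall i t, f i ^+ N *: g t = \sum_l P i t l *: b i l) /\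
  (forall v : T -> A, \sum_t v t *: g t = 0 ->
     forall i l, f i ^+ E * \sum_t v t * P i t l = 0).
Proof.
have [N [P PE]] := uniform_coordinates.
(* E kills the i-th coordinates of the relation
   f_k^N g_t = sum_l' P k t l' b_kl', for all i, k and t. *)
have [it Nn N' le_N yN l k||E EE] := @exists_uniform_bound
    ('I_m * T)%type (fun it E => forall l k, f it.1 ^+ E *
      (f k ^+ N * P it.1 it.2 l
        - \sum_l' P k it.2 l' * P it.1 (k, l') l) = 0).
- by rewrite -(subnK le_N) exprD -mulrA yN mulr0.
- case=> i t /=.
  pose y (lk : 'I_d * 'I_m) := f lk.2 ^+ N * P i t lk.1
    - \sum_l' P lk.2 t l' * P i (lk.2, l') lk.1.
  have [|E yE] := @torsion_uniform _ i y; last by exists E => l k; exact: (yE (l, k)).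
  case=> l k; rewrite /y /=; move: l.
  apply: (b_basis i).2.
  under eq_bigr do rewrite scalerBl -scalerA scaler_suml.
  rewrite sumrB -scaler_sumr -PE exchange_big /=.
  under [X in _ - X]eq_bigr => l' _.
    under eq_bigr do rewrite -scalerA.
    rewrite -scaler_sumr -PE scalerA mulrC -scalerA.
    over.
  by rewrite -scaler_sumr scalerA mulrC -scalerA PE subrr.
exists N, E, P; split=> // v v0 i l.
have cocycle k t l' : f i ^+ E * (f k ^+ N * P i t l')
    = f i ^+ E * \sum_l'' P k t l'' * P i (k, l'') l'.
  by apply/eqP; rewrite -subr_eq0 -mulrBr; apply/eqP; exact: (EE (i, t) l' k).
have relP k l' : exists K, f k ^+ K * \sum_t v t * P k t l' = 0.
  move: l'; apply: (b_basis k).2.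
  under eq_bigr do rewrite scaler_suml.
  rewrite exchange_big /=.
  under eq_bigr => t _.
    under eq_bigr do rewrite -scalerA.
    rewrite -scaler_sumr -PE scalerA mulrC -scalerA.
    over.
  by rewrite -scaler_sumr v0 scaler0.
apply: (@local_mem _ A^o (fun y => y = 0) _ _ _ _ _ _ _ cf1) => //.
- by move=> x y -> ->; rewrite addr0.
- by move=> a x ->; rewrite scaler0.
move=> k; have [K KE] := torsion_uniform (relP k).
exists (K + N)%N.
rewrite -[LHS]/(f k ^+ (K + N) * (f i ^+ E * \sum_t v t * P i t l)).
rewrite exprD -mulrA [f k ^+ N * _]mulrCA.
have -> : f i ^+ E * (f k ^+ N * \sum_t v t * P i t l)
        = f i ^+ E * \sum_l' (\sum_t v t * P k t l') * P i (k, l') l.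
  under [in RHS]eq_bigr do rewrite mulr_suml.
  rewrite exchange_big /= !mulr_sumr; apply: eq_bigr => t _.
  under [in RHS]eq_bigr do rewrite -mulrA.
  rewrite -mulr_sumr [RHS]mulrCA -cocycle.
  by rewrite [f k ^+ N * (v t * _)]mulrCA [LHS]mulrCA.
rewrite mulrCA mulr_sumr big1 ?mulr0 // => l' _.
by rewrite mulrA KE mul0r.
Qed.

End Gluing.

(** Multiplication by f_i^(E + N) factors as x |-> sum_l co_il(x) b_il, where
    f_i^E makes the coordinates well defined and f_i^N clears denominators; a
    combination of these over i with sum_i a_i f_i^(E + N) = 1 is the identity. *)
Lemma locally_free_dual_basis d : locally_free V d ->
  exists (T : finType) (e : T -> V) (eps : T -> V -> A), dual_basis e eps.
Proof.
move=> [m [f [[c cf1] phi]]].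
have /choice[b b_basis] : forall i, exists b : 'I_d -> V, basis_away (f i) b.
  by move=> i; have [phi_i bij] := phi i; exact: loc_free_basis bij.
have [N [E [P [PE relP]]]] := relation_coordinates cf1 b_basis.
have [v vE] := choice (glued_generators cf1 b_basis).
pose g (t : 'I_m * 'I_d) := b t.1 t.2.
(* v x is a chosen lift of x to the free module on the g_t; [co_eq] shows that
   the coordinates do not depend on the choice. *)
pose co (w : 'I_m * 'I_d -> A) i l := f i ^+ E * \sum_t w t * P i t l.
have co_eq w w' i l : \sum_t w t *: g t = \sum_t w' t *: g t ->
    co w i l = co w' i l.
  move=> ww'; apply/eqP; rewrite -subr_eq0 -mulrBr -sumrB.
  under eq_bigr do rewrite -mulrBl.
  apply/eqP; apply: (relP (fun t => w t - w' t)).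
  under eq_bigr do rewrite scalerBl.
  by rewrite sumrB ww' subrr.
have [a aE] : exists a, \sum_i a i * f i ^+ (E + N) = 1.
  apply: (@local_mem _ A^o (fun y => exists a, \sum_i a i * f i ^+ (E + N) = y)
    _ _ _ _ _ _ _ cf1).
  - by exists (fun=> 0); rewrite big1 // => i _; rewrite mul0r.
  - move=> _ _ [a <-] [a' <-]; exists (fun i => a i + a' i).
    by rewrite -big_split; apply: eq_bigr => i _; rewrite mulrDl.
  - move=> u _ [a <-]; exists (fun i => u * a i); rewrite -[RHS]/(u * _) mulr_sumr.
    by apply: eq_bigr => i _; rewrite mulrA.
  - move=> i; exists (E + N)%N, (fun j => (j == i)%:R).
    rewrite -[RHS]/(f i ^+ (E + N) * 1) mulr1 (bigD1 i) //= eqxx mul1r.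
    by rewrite big1 ?addr0 // => j /negPf->; rewrite mul0r.
exists ('I_m * 'I_d)%type, g, (fun t x => a t.1 * co (v x) t.1 t.2); split.
- move=> [i l] x y /=; rewrite -mulrDr; congr (_ * _).
  rewrite (@co_eq _ (fun t => v x t + v y t)).
    by rewrite -mulrDr -big_split; congr (_ * _); apply: eq_bigr => t _; rewrite mulrDl.
  under [in RHS]eq_bigr do rewrite scalerDl.
  by rewrite big_split /= -!vE.
- move=> [i l] u x /=; rewrite [RHS]mulrCA; congr (_ * _).
  rewrite (@co_eq _ (fun t => u * v x t)).
    rewrite mulrCA mulr_sumr; congr (_ * _).
    by apply: eq_bigr => t _; rewrite mulrA.
  under [in RHS]eq_bigr do rewrite -scalerA.
  by rewrite -scaler_sumr -!vE.
- move=> x.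
  rewrite -(pair_bigA _ (fun i l => (a i * co (v x) i l) *: b i l)) /=.
  rewrite -[LHS]scale1r -aE scaler_suml; apply: eq_bigr => i _.
  under [in RHS]eq_bigr do rewrite -scalerA.
  rewrite -scalerA -scaler_sumr; congr (_ *: _).
  rewrite /co; under [in RHS]eq_bigr do rewrite -scalerA scaler_suml.
  rewrite -scaler_sumr exprD -scalerA; congr (_ *: _).
  rewrite exchange_big /=.
  under [in RHS]eq_bigr => t _.
    under eq_bigr do rewrite -scalerA.
    rewrite -scaler_sumr -PE scalerA mulrC -scalerA.
    over.
  by rewrite -scaler_sumr -vE.
Qed.

End DualBasis.

(** * Reduction modulo an ideal *)

Section BaseChange.
Variables (k : comNzRingType) (S : comAlgType k) (A B : comPzRingType).
Variables (iota : {rmorphism k -> A}) (g : {rmorphism A -> B}).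

Local Notation SA := (ext S iota).
Local Notation SB := (ext S (g \o iota)).

Lemma ext_mapM : {morph ext_map S iota g : x y / x * y}.
Proof.
move=> x y; elim/ext_ind: x => [s a|x x' IHx IHx']; last first.
  rewrite (mulrDl x x' y).
  rewrite (ext_mapD _ (x * y)).
  rewrite (ext_mapD _ x x').
  by rewrite IHx IHx' [RHS]mulrDl.
elim/ext_ind: y => [s' a'|y y' IHy IHy']; last first.
  rewrite (mulrDr _ y y').
  rewrite (ext_mapD _ (etens iota s a * y)) (ext_mapD _ y) IHy IHy'.
  by rewrite [RHS]mulrDr.
by rewrite etensM !ext_mapE etensM rmorphM.
Qed.

Fact ext_map_zmod_morphism : zmod_morphism (ext_map S iota g).
Proof.
move=> x y; apply: (addIr (ext_map S iota g y)).
by rewrite subrK -(ext_mapD _ (x - y) y) subrK.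
Qed.

Fact ext_map_monoid_morphism : monoid_morphism (ext_map S iota g).
Proof. by split; [rewrite ext_mapE rmorph1|exact: ext_mapM]. Qed.

HB.instance Definition _ := GRing.isZmodMorphism.Build SA SB
  (ext_map S iota g) ext_map_zmod_morphism.
HB.instance Definition _ := GRing.isMonoidMorphism.Build SA SB
  (ext_map S iota g) ext_map_monoid_morphism.

Lemma ext_map_surj :
    (forall b, exists a, g a = b) ->
  forall y : SB, exists x, ext_map S iota g x = y.
Proof.
move=> g_surj; elim/ext_ind => [s b|y y' [x <-] [x' <-]]; last first.
  by exists (x + x'); rewrite rmorphD.
by have [a <-] := g_surj b; exists (etens iota s a); rewrite ext_mapE.
Qed.

Definition ext_row r (v : 'rV[SA]_r) : 'rV[SB]_r := map_mx (ext_map S iota g) v.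

Lemma ext_row_surj r : (forall b, exists a, g a = b) ->
  forall w : 'rV[SB]_r, exists v, ext_row v = w.
Proof.
move=> /ext_map_surj surj w.
have /choice[v vE] : forall j, exists x, ext_map S iota g x = w 0 j by [].
by exists (\row_j v j); apply/rowP => j; rewrite !mxE vE.
Qed.

Lemma ext_row_outer r1 r2 (u : 'rV[SA]_r1) (v : 'rV[SA]_r2) :
  ext_row (mxvec (u^T *m v)) = mxvec ((ext_row u)^T *m ext_row v).
Proof.
apply/rowP => ij; case/mxvec_indexP: ij => i j.
by rewrite mxE !mxvecE !mxE !big_ord1 rmorphM !mxE.
Qed.

Variable M : lmodType SA.

Lemma bchange_map_ext_row r (p : {linear 'rV[SA]_r -> M}) v :
  bchange_map g p (ext_row v) = btens g (p v) 1.
Proof.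
rewrite -bchange_mapE; congr (bchange_map g p _); apply/rowP => j.
by rewrite !mxE -[etens _ 1 1]/(1 : SB) mulr1.
Qed.

End BaseChange.

Arguments ext_row {k S A B} iota g {r} v.

Section Reduction.
Variables (k : comNzRingType) (S : comAlgType k) (A : comPzRingType).
Variables (iota : {rmorphism k -> A}) (J : ideal A).

Local Notation SA := (ext S iota).
Local Notation red := (ext_row iota (quotpi J)).

Lemma quotpi_eq0 a : quotpi J a = 0 <-> a \in J.
Proof.
by rewrite -(rmorph0 (quotpi J)) -{2}[a]subr0; split=> /quotpiP.
Qed.

(** The maps m (x) b |-> eps_t(m) b to A/J detect the coordinates modulo J;
    conversely m = sum_t eps_t(m) e_t lies in J M
    once they lie in J. *)
Lemma btens1_eq0 (M : lmodType SA) (T : finType) (e : T -> M)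
    (eps : T -> M -> A) (m : M) :
    dual_basis (e : T -> restr (ext_in S iota) M) eps ->
  btens (quotpi J) m 1 = 0 <-> forall t, eps t m \in J.
Proof.
move=> [epsD epsZ epsE]; split=> [m0 t|Jm].
- have bal : balanced (fun (x : restr (ext_in S iota) M)
      (b : restr (quotpi J) (quotring J)^o) => quotpi J (eps t x) * (b : quotring J)).
    split=> [x y b|x b b'|a x b].
    + by rewrite epsD rmorphD mulrDl.
    + by rewrite mulrDr.
    + rewrite epsZ rmorphM -mulrA; exact: mulrCA.
  have := tensor_lift_tens bal m 1.
  rewrite -[tens _ _]/(btens (quotpi J) m 1) m0 -(tclass0 _ _).
  rewrite (tensor_lift_class bal) big_nil mulr1 => /esym.
  by move/quotpi_eq0.
rewrite (epsE m).
rewrite (big_morph (fun x : restr (ext_in S iota) M => btens (quotpi J) x 1)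
  (fun x y => btensDl (quotpi J) x y 1) (id1 := 0)); last exact: tens0l.
apply: big1 => t _.
transitivity (btens (quotpi J) (e t) 0); last first.
  by apply: (addrI (btens (quotpi J) (e t) 0)); rewrite -btensDr !addr0.
transitivity (btens (quotpi J) (e t) (quotpi J (eps t m) * 1)).
  exact: (btensZ (quotpi J) (eps t m) (e t) 1).
by rewrite mulr1; congr btens; apply/quotpi_eq0.
Qed.

(** Right exactness of - (x) A/J, in the form that K (x) A/J maps onto the
    kernel of the reduction of p. *)
Lemma ker_lift r d (M : lmodType SA) (p : {linear 'rV[SA]_r -> M}) :
    (forall x, exists v, p v = x) -> locally_free (restr (ext_in S iota) M) d ->
  forall w, bchange_map (quotpi J) p w = 0 -> exists2 u, p u = 0 & red u = w.
Proof.
move=> p_surj /locally_free_dual_basis[T [e [eps dual]]] w pw0.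
have [v vw] := @ext_row_surj _ S _ _ iota (quotpi J) _ (@quotpi_surj _ J) w.
have pv0 : btens (quotpi J) (p v) 1 = 0 by rewrite -bchange_map_ext_row vw.
have Jv := (btens1_eq0 _ dual).1 pv0.
have [_ _ epsE] := dual.
have [h hE] := choice (fun t => p_surj (e t)).
(* p v lies in J M: its coordinates are in J.  Lifting the e_t along p gives a
   vector with the same image as v and zero reduction. *)
exists (v - \sum_t ext_in S iota (eps t (p v)) *: h t).
  rewrite linearB linear_sum /= {1}(epsE (p v)); apply/eqP; rewrite subr_eq0.
  by apply/eqP/eq_bigr => t _; rewrite linearZ /= hE.
rewrite /ext_row map_mxB -/(red v) vw map_mx_sum big1 ?subr0 // => t _.
rewrite map_mxZ -[RHS](scale0r (red (h t))); congr (_ *: _).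
transitivity (ext_in S (quotpi J \o iota) (quotpi J (eps t (p v)))).
  exact: ext_mapE.
rewrite -(rmorph0 (ext_in S (quotpi J \o iota))).
by congr ext_in; apply/quotpi_eq0.
Qed.

End Reduction.

(** * Vanishing of the maps psi on pure tensors *)

Section PsiVanishing.
Variables (R : comPzRingType) (r1 r2 : nat) (M1 M2 M3 : lmodType R).
Variables (p1 : {linear 'rV[R]_r1 -> M1}) (p2 : {linear 'rV[R]_r2 -> M2}).
Variable p3 : {linear 'rV[R]_(r1 * r2) -> M3}.

Lemma tensor_mapD (M N M' N' : lmodType R) (f : {linear M -> M'})
    (g : {linear N -> N'}) :
  {morph tensor_map f g : x y / x + y}.
Proof.
apply: tensor_liftD; split=> [m1 m2 n1|m1 n1 n2|a m1 n1] /=.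
- by rewrite linearD tensDl.
- by rewrite linearD tensDr.
- by rewrite !linearZ tensZ.
Qed.

Lemma free_tensorD : {morph @free_tensor R r1 r2 : x y / x + y}.
Proof.
apply: tensor_liftD; split=> [u1 u2 v1|u1 v1 v2|a u1 v1].
- by rewrite linearD mulmxDl linearD.
- by rewrite mulmxDr linearD.
- by rewrite linearZ /= -scalemxAl -scalemxAr.
Qed.

Lemma psi1_eq0 : (forall z, psi1 p1 p3 z = 0) <->
  (forall u v, p1 u = 0 -> p3 (mxvec (u^T *m v)) = 0).
Proof.
split=> [psi0 u v u0|p0].
  have ku : u \in in_ker p1 by rewrite unfold_in u0.
  by rewrite -(psi1_tens p3 (Ker ku)) psi0.
elim/tensor_ind => [u v|x y IHx IHy].
  by rewrite psi1_tens p0 //; apply/eqP; case: u.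
rewrite /psi1 in IHx IHy *; rewrite (tensor_mapD (val : {linear ker p1 -> 'rV_r1}) idfun x y).
rewrite free_tensorD linearD /= -[RHS]addr0; congr (_ + _); [exact: IHx|exact: IHy].
Qed.

Lemma psi2_eq0 : (forall z, psi2 p2 p3 z = 0) <->
  (forall u v, p2 v = 0 -> p3 (mxvec (u^T *m v)) = 0).
Proof.
split=> [psi0 u v v0|p0].
  have kv : v \in in_ker p2 by rewrite unfold_in v0.
  by rewrite -(psi2_tens p3 u (Ker kv)) psi0.
elim/tensor_ind => [u v|x y IHx IHy].
  by rewrite psi2_tens p0 //; apply/eqP; case: v.
rewrite /psi2 in IHx IHy *; rewrite (tensor_mapD idfun (val : {linear ker p2 -> 'rV_r2}) x y).
rewrite free_tensorD linearD /= -[RHS]addr0; congr (_ + _); [exact: IHx|exact: IHy].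
Qed.

End PsiVanishing.

(** * Ideals generated by a set *)

Section GeneratedIdeal.
Variables (A : comPzRingType) (G : A -> Prop).

(** As an intersection of ideals rather than a set of finite combinations, it
    has its universal property by construction. *)
Definition gen_ideal_pred : {pred A} :=
  fun a => `[< forall J : ideal A, (forall x, G x -> x \in J) -> a \in J >].

Fact gen_ideal0 : 0 \in gen_ideal_pred.
Proof. by apply/asboolP => J _; exact: ideal0. Qed.

Fact gen_idealD : {in gen_ideal_pred &, forall x y, x + y \in gen_ideal_pred}.
Proof.
move=> x y /asboolP Gx /asboolP Gy; apply/asboolP => J GJ.
by apply: idealD; [exact: Gx|exact: Gy].
Qed.

Fact gen_idealM a : {in gen_ideal_pred, forall x, a * x \in gen_ideal_pred}.
Proof.
by move=> x /asboolP Gx; apply/asboolP => J GJ; apply: idealM; exact: Gx.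
Qed.

Definition gen_ideal : ideal A := Ideal gen_ideal0 gen_idealD gen_idealM.

Lemma gen_ideal_sub (J : ideal A) :
  {subset gen_ideal <= J} <-> (forall x, G x -> x \in J).
Proof.
split=> [GJ x Gx|GJ x /asboolP]; last exact.
by apply: GJ; apply/asboolP => J'; exact.
Qed.

End GeneratedIdeal.

(** * The ideal of vanishing *)

Theorem theorem3p7 (k : closedFieldType)
  (k_infinite : forall s : seq k, exists x : k, x \notin s)
  (n d1 d2 d3 r1 r2 : nat)
  (n_ge1 : (1 <= n)%N) (d1_ge1 : (1 <= d1)%N) (d2_ge1 : (1 <= d2)%N)
  (d3_ge1 : (1 <= d3)%N) (r1_ge1 : (1 <= r1)%N) (r2_ge1 : (1 <= r2)%N)
  (A : comPzRingType) (iota : {rmorphism k -> A})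
  (M1 M2 M3 : lmodType (ext {mpoly k[n]} iota))
  (p1 : {linear 'rV[ext {mpoly k[n]} iota]_r1 -> M1})
  (p2 : {linear 'rV[ext {mpoly k[n]} iota]_r2 -> M2})
  (p3 : {linear 'rV[ext {mpoly k[n]} iota]_(r1 * r2) -> M3})
  (p1_quot : is_quot_point d1 p1)
  (p2_quot : is_quot_point d2 p2)
  (p3_quot : is_quot_point d3 p3) :
  exists I : ideal A, forall J : ideal A,
    let SB := ext {mpoly k[n]} (quotpi J \o iota) in
    let p1' : {linear 'rV[SB]_r1 -> bchange (quotpi J) M1} :=
      bchange_map (quotpi J) p1 in
    let p2' : {linear 'rV[SB]_r2 -> bchange (quotpi J) M2} :=
      bchange_map (quotpi J) p2 in
    let p3' : {linear 'rV[SB]_(r1 * r2) -> bchange (quotpi J) M3} :=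
      bchange_map (quotpi J) p3 in
    ((forall z, psi1 p1' p3' z = 0) /\ (forall z, psi2 p2' p3' z = 0))
    <-> {subset I <= J}.
Proof.
have [p1_surj M1_free] := p1_quot.
have [p2_surj M2_free] := p2_quot.
have [_ /locally_free_dual_basis[T [e [eps dual]]]] := p3_quot.
pose G a := exists t u v,
  (p1 u = 0 \/ p2 v = 0) /\ a = eps t (p3 (mxvec (u^T *m v))).
exists (gen_ideal G) => J SB p1' p2' p3'.
rewrite gen_ideal_sub psi1_eq0 psi2_eq0.
have p3'_eq0 u v :
    p3' (mxvec ((ext_row iota (quotpi J) u)^T *m ext_row iota (quotpi J) v)) = 0
    <-> forall t, eps t (p3 (mxvec (u^T *m v))) \in J.
  rewrite -ext_row_outer [p3' _](bchange_map_ext_row _ p3).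
  exact: (btens1_eq0 J _ dual).
split=> [[psi1_0 psi2_0] _ [t [u [v [uv0 ->]]]]|GJ].
  move: t; apply/p3'_eq0; case: uv0 => [u0|v0].
    apply: psi1_0; apply: etrans (bchange_map_ext_row _ _ _) _.
    by rewrite u0; exact: tens0l.
  apply: psi2_0; apply: etrans (bchange_map_ext_row _ _ _) _.
  by rewrite v0; exact: tens0l.
split=> u' v' ker0.
  have [u u0 <-] := ker_lift p1_surj M1_free ker0.
  have [v <-] := ext_row_surj (@quotpi_surj _ J) v'.
  by apply/p3'_eq0 => t; apply: GJ; exists t, u, v; split; [left|].
have [v v0 <-] := ker_lift p2_surj M2_free ker0.
have [u <-] := ext_row_surj (@quotpi_surj _ J) u'.
by apply/p3'_eq0 => t; apply: GJ; exists t, u, v; split; [right|].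
Qed.
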